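(* Let $[B]\sqsubseteq[A]$, that is, $\operatorname{Row}(A)\subseteq\operatorname{Row}(B)$, and let $T$ be a real matrix with $A=TB$. Then for every $f\in\mathbb{C}^A$ it holds that $\mathcal{A}(f)\subset\mathcal{A}_B(f)$ and $\iota(\mathcal{A}(f))\subset\mathcal{L}_B(f)$.
   Context: $A\subset\mathbb{R}^{1+n}$ is a finite set of cardinality $N$; its elements $\alpha(1),\dots,\alpha(N)$ are arranged as the columns of a $(1+n)\times N$ matrix, also denoted $A$. It is assumed that $A$ is pseudo-homogeneous: there is a linear form $\xi$ with $\langle\xi,\alpha\rangle=1$ for all $\alpha\in A$, i.e. $\mathbf{1}=(1,\dots,1)$ lies in the real row span $\operatorname{Row}(A)$. $\mathbb{C}^A$ is the space of exponential sums $f(\mathbf{z})=\sum_{j=1}^N c_j e^{\langle\mathbf{z},\alpha(j)\rangle}$, $c_j\in\mathbb{C}$, in $\mathbf{z}\in\mathbb{C}^{1+n}$. The amoeba of $f$ is $\mathcal{A}(f)=\overline{\operatorname{Re}(V(f))}\subset\mathbb{R}^{1+n}$, where $V(f)\subset\mathbb{C}^{1+n}$ is the zero set of $f$, $\operatorname{Re}$ is taken coordinatewise, and the closure is in the standard topology; the same definitions are used for other supports. $B$ is a real $(1+m)\times N$ matrix with columns $\beta(1),\dots,\beta(N)$, also pseudo-homogeneous, and $A=TB$ with $T$ a real $(1+n)\times(1+m)$ matrix. The isomorphism $\Phi\colon\mathbb{C}^A\to\mathbb{C}^B$ sends $\sum_j c_j e^{\langle\mathbf{z},\alpha(j)\rangle}$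 to $\sum_j c_j e^{\langle\mathbf{y},\beta(j)\rangle}$ ($\mathbf{y}\in\mathbb{C}^{1+m}$), so $f(\mathbf{z})=(\Phi f)(\mathbf{z}T)$, where $\mathbf{z}$ is regarded as a row vector. The map $\iota\colon\mathbb{R}^{1+n}\to\mathbb{R}^{1+m}$ is $\mathbf{x}\mapsto\mathbf{x}T$, with image $H_T$. The large $B$-caisson is $\mathcal{L}_B(f)=\mathcal{A}(\Phi f)\subset\mathbb{R}^{1+m}$. The small $B$-caisson $\mathcal{A}_B(f)$ is $\mathcal{L}_B(f)\cap H_T$, considered as a subset of $\mathbb{R}^{1+n}$ by taking its inverse image under $\iota$, i.e. $\mathcal{A}_B(f)=\iota^{-1}(\mathcal{L}_B(f))$. *)

(* Defs.v *)
From mathcomp Require Import all_boot all_order all_algebra.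
From mathcomp Require Import ring complex.
From mathcomp Require Import all_classical all_reals all_analysis.

Set Implicit Arguments.
Unset Strict Implicit.
Unset Printing Implicit Defensive.

Import Order.TTheory GRing.Theory Num.Theory.
Import numFieldNormedType.Exports.

Local Open Scope classical_set_scope.
Local Open Scope ring_scope.
Local Open Scope complex_scope.

(* A finite support in R^k of cardinality N is a k x N matrix with pairwise
   distinct columns. Points of R^k and C^k are row vectors throughout. *)
Definition distinct_cols (R : realType) (k N : nat) (A : 'M[R]_(k, N)) :=
  injective (fun j : 'I_N => col j A).

(* The linear form is represented by the row vector [xi]. *)
Definition pseudo_homogeneous (R : realType) (k N : nat) (A : 'M[R]_(k, N)) :=
  exists xi : 'rV[R]_k, xi *m A = const_mx 1.

Definition cexp (R : realType) (w : R[i]) : R[i] :=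
  (expR (complex.Re w))%:C * (cos (complex.Im w) +i* sin (complex.Im w)).

(* The pairing <z, alpha(j)> is bilinear (no conjugation): it is the j-th entry
   of the row vector z A. *)
Definition expsum (R : realType) (k N : nat) (A : 'M[R]_(k, N))
    (c : 'rV[R[i]]_N) (z : 'rV[R[i]]_k) : R[i] :=
  \sum_(j < N) c 0 j * cexp ((z *m map_mx (real_complex R) A) 0 j).

(* The space C^A, as a set of functions on C^k. *)
Definition expsums (R : realType) (k N : nat) (A : 'M[R]_(k, N)) :
    set ('rV[R[i]]_k -> R[i]) :=
  range (expsum A).

Definition zeros (R : realType) (k : nat) (f : 'rV[R[i]]_k -> R[i]) :
    set 'rV[R[i]]_k :=
  [set z | f z = 0].

Definition amoeba (R : realType) (k : nat) (f : 'rV[R[i]]_k -> R[i]) :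
    set 'rV[R]_k :=
  closure (map_mx (@complex.Re R) @` zeros f).

(* The coefficients of f in C^A; they are unique when A has distinct columns,
   see [expsum_inj]. *)
Definition coefs (R : realType) (k N : nat) (A : 'M[R]_(k, N))
    (f : 'rV[R[i]]_k -> R[i]) : 'rV[R[i]]_N :=
  xget 0 [set c | expsum A c = f].

(* See [PhiE] for the defining property. *)
Definition Phi (R : realType) (k l N : nat) (A : 'M[R]_(k, N))
    (B : 'M[R]_(l, N)) (f : 'rV[R[i]]_k -> R[i]) : 'rV[R[i]]_l -> R[i] :=
  expsum B (coefs A f).

Definition iota_map (R : realType) (k l : nat) (T : 'M[R]_(k, l)) (x : 'rV[R]_k) :
    'rV[R]_l :=
  x *m T.

Definition large_caisson (R : realType) (k l N : nat) (A : 'M[R]_(k, N))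
    (B : 'M[R]_(l, N)) (f : 'rV[R[i]]_k -> R[i]) : set 'rV[R]_l :=
  amoeba (Phi A B f).

(* The intersection with the image H_T of [iota_map T] is implicit in the
   preimage. *)
Definition small_caisson (R : realType) (k l N : nat) (A : 'M[R]_(k, N))
    (B : 'M[R]_(l, N)) (T : 'M[R]_(k, l)) (f : 'rV[R[i]]_k -> R[i]) :
    set 'rV[R]_k :=
  iota_map T @^-1` large_caisson A B f.

Lemma cexpD (R : realType) (v w : R[i]) : cexp (v + w) = cexp v * cexp w.
Proof.
case: v => a b; case: w => c d; rewrite /cexp /= expRD cosD sinD.
by apply/eqP; rewrite eq_complex /=; apply/andP; split; apply/eqP; ring.
Qed.

Lemma cexp_real (R : realType) (a : R) : cexp a%:C = (expR a)%:C.
Proof.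
by rewrite /cexp /= cos0 sin0 -[1 +i* 0]/(1%:C) mulr1.
Qed.

Lemma expsum0_coef0 (R : realType) (k N : nat) (A : 'M[R]_(k, N))
    (c : 'rV[R[i]]_N) :
  distinct_cols A -> (forall z, expsum A c z = 0) -> c = 0.
Proof.
move=> injA; have [s] := ubnP #|[pred j | c 0 j != 0]|.
elim: s c => // s IHs c; rewrite ltnS => lecs c0.
apply/rowP => a; rewrite mxE; apply/eqP/negPn/negP => ca0.
pose Ac := map_mx (real_complex R) A.
have cb0 b : b != a -> c 0 b = 0.
  move=> neba; apply/eqP/negPn/negP => cbN0.
  have [i Aiab] : exists i, A i b != A i a.
    apply: contrapT => nex; move/eqP: neba; apply; apply: injA.
    apply/colP => i; rewrite !mxE; apply/eqP/negPn/negP => ne.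
    by apply: nex; exists i.
  pose w : 'rV[R[i]]_k := delta_mx 0 i.
  have wE j : (w *m Ac) 0 j = (A i j)%:C.
    by rewrite -rowE !mxE.
  pose d : 'rV[R[i]]_N :=
    \row_j (c 0 j * (cexp ((w *m Ac) 0 j) - cexp ((w *m Ac) 0 a))).
  have dN0 : d 0 b != 0.
    rewrite mxE mulf_neq0 // subr_eq0 !wE !cexp_real.
    apply: contra Aiab => /eqP/(congr1 (@complex.Re R)) /= /expR_inj ->.
    exact: eqxx.
  suff d0 : d = 0 by rewrite d0 mxE eqxx in dN0.
  apply: IHs.
    apply: leq_trans lecs; apply/proper_card/properP; split.
      apply/fintype.subsetP => j; rewrite !inE mxE; apply: contra => /eqP ->.
      by rewrite mul0r.
    by exists a; rewrite !inE // mxE subrr mulr0 eqxx.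
  move=> z.
  transitivity (expsum A c (z + w) - cexp ((w *m Ac) 0 a) * expsum A c z).
    rewrite /expsum mulr_sumr -sumrB; apply: eq_bigr => j _.
    rewrite mulmxDl !mxE cexpD mulrBr mulrBl.
    congr (_ - _); first by rewrite -mulrA; congr (_ * _); rewrite mulrC.
    by rewrite mulrAC mulrC.
  by rewrite !c0 mulr0 subrr.
move: (c0 0); rewrite /expsum (bigD1 a) //= big1 => [|j /cb0 ->]; last first.
  by rewrite mul0r.
rewrite addr0 mul0mx mxE -[X in cexp X]/(0%:C) cexp_real expR0 mulr1 => /eqP.
by apply/negP.
Qed.

Lemma expsum_inj (R : realType) (k N : nat) (A : 'M[R]_(k, N)) :
  distinct_cols A -> injective (expsum A).
Proof.
move=> injA c d ecd; apply/eqP; rewrite -subr_eq0; apply/eqP.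
apply: (expsum0_coef0 injA) => z.
transitivity (expsum A c z - expsum A d z); last by rewrite ecd subrr.
by rewrite /expsum -sumrB; apply: eq_bigr => j _; rewrite !mxE mulrBl.
Qed.

Lemma PhiE (R : realType) (k l N : nat) (A : 'M[R]_(k, N)) (B : 'M[R]_(l, N))
    (c : 'rV[R[i]]_N) :
  distinct_cols A -> Phi A B (expsum A c) = expsum B c.
Proof.
move=> injA; rewrite /Phi /coefs; congr (expsum B _).
by apply: xget_subset1 => // d e /= <- /(expsum_inj injA).
Qed.

(* Main.v *)
Require Import Defs.
From mathcomp Require Import all_boot all_order all_algebra.
From mathcomp Require Import complex.
From mathcomp Require Import all_classical all_reals all_analysis.

Import GRing.Theory numFieldNormedType.Exports.

Local Open Scope classical_set_scope.
Local Open Scope ring_scope.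
Local Open Scope complex_scope.

(** Since $A=TB$, a zero $z$ of $f$ gives the zero $zT$ of $\Phi f$ ([expsum_mulmx]). As $T$ is
    real, $\operatorname{Re}(zT)=\operatorname{Re}(z)T$ ([map_mx_Re_mulmx]), so $\iota$ carries real
    parts of zeros to real parts of zeros. Continuity of $\iota$ extends this to the closures
    ([image_closure_subset]). *)

Lemma mulmxr_continuous (K : numFieldType) (k l : nat) (M : 'M[K]_(k, l)) :
  continuous (fun x : 'rV[K]_k => x *m M).
Proof.
have -> : (fun x : 'rV[K]_k => x *m M) =
          fun x : 'rV[K]_k => \sum_i x 0 i *: row i M.
  by apply/funext => x; exact: mulmx_sum_row.
apply: continuous_big => [|i _ x]; first exact: add_continuous.
by apply: continuousZr_tmp; exact: coord_continuous.
Qed.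

Lemma image_closure_subset (X Y : topologicalType) (f : X -> Y) (S : set X) :
  continuous f -> f @` closure S `<=` closure (f @` S).
Proof.
(* By continuity the preimage of [V] is a neighbourhood of [x], hence meets [S]. *)
move=> fC _ [x Sx <-] V /fC /Sx[y [Sy Vfy]].
by exists (f y); split => //; exists y.
Qed.

(** A real factor contributes no product of imaginary parts to the real part. *)
Lemma map_mx_Re_mulmx (R : realType) (p q r : nat) (z : 'M[R[i]]_(p, q))
    (M : 'M[R]_(q, r)) :
  map_mx (@complex.Re R) (z *m map_mx (real_complex R) M) =
  map_mx (@complex.Re R) z *m M.
Proof.
apply/matrixP => i j; rewrite !mxE raddf_sum; apply: eq_bigr => s _.
by rewrite !mxE; case: (z i s) => a b /=; rewrite mulr0 subr0.
Qed.

(** This is $f(z)=(\Phi f)(zT)$ at the level of coefficients: the exponents agree because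
    $z(TB)=(zT)B$. *)
Lemma expsum_mulmx (R : realType) (k l N : nat) (T : 'M[R]_(k, l))
    (B : 'M[R]_(l, N)) (c : 'rV[R[i]]_N) (z : 'rV[R[i]]_k) :
  expsum (T *m B) c z = expsum B c (z *m map_mx (real_complex R) T).
Proof. by rewrite /expsum map_mxM mulmxA. Qed.

Lemma iota_amoeba_subset (R : realType) (k l N : nat) (T : 'M[R]_(k, l))
    (B : 'M[R]_(l, N)) (c : 'rV[R[i]]_N) :
  iota_map T @` amoeba (expsum (T *m B) c) `<=` amoeba (expsum B c).
Proof.
apply: subset_trans (image_closure_subset _ _ _ _ (mulmxr_continuous _ _ _ T)) _.
apply: closureS => _ [_ [z z0 <-] <-].
exists (z *m map_mx (real_complex R) T); last exact: map_mx_Re_mulmx.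
by rewrite /zeros /= -expsum_mulmx.
Qed.

Theorem theorem4p1 (R : realType) (n m N : nat)
    (A : 'M[R]_(1 + n, N)) (B : 'M[R]_(1 + m, N)) (T : 'M[R]_(1 + n, 1 + m))
    (A_distinct : distinct_cols A)
    (A_pseudo : pseudo_homogeneous A)
    (B_pseudo : pseudo_homogeneous B)
    (Row_AB : (A <= B)%MS)
    (A_TB : A = T *m B)
    (f : 'rV[R[i]]_(1 + n) -> R[i])
    (f_A : expsums A f) :
  amoeba f `<=` small_caisson A B T f /\
  iota_map T @` amoeba f `<=` large_caisson A B f.
Proof.
have iotaA : iota_map T @` amoeba f `<=` large_caisson A B f.
  (* Distinctness of the columns of [A] makes [c] the coefficient vector that [Phi] transfers to
     [B]. *)
  case: f_A => c _ <-; rewrite /large_caisson PhiE // A_TB.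
  exact: iota_amoeba_subset.
(* The small caisson is a preimage under $\iota$, so its inclusion is the one for the image read
   pointwise. *)
by split => // x fx; apply: iotaA; exists x.
Qed.
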